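(* For every real number $a\ge2$, the graph of $\{\lfloor n^a\rfloor\}_{n=1}^\infty$ does not contain any arithmetic progression of length $3$.
   Context: $\mathbb{N}=\{1,2,\ldots\}$. A sequence $\{p(j)\}_{j=0}^{2}\subset\mathbb{N}^2$ is an arithmetic progression of length $3$ if there is $D\in\mathbb{N}^2$ (so both components of $D$ are positive) with $p(j)=p(0)+jD$ for $j=0,1,2$. The graph of a sequence $\{a(n)\}_{n=1}^\infty\subset\mathbb{N}$ is the set $\{(n,a(n))\in\mathbb{N}^2\mid n\in\mathbb{N}\}$. *)

(* Defs.v *)
From mathcomp Require Import all_boot all_order all_algebra.
From mathcomp Require Import all_classical all_reals all_analysis.
Set Implicit Arguments.
Unset Strict Implicit.
Unset Printing Implicit Defensive.
Import Order.TTheory GRing.Theory Num.Theory.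
Local Open Scope classical_set_scope.
Local Open Scope ring_scope.

(* Here N = {1, 2, ...}: N^2 is the set of pairs of positive natural numbers. *)
Definition posN2 : set (nat * nat) := [set q | (0 < q.1)%N /\ (0 < q.2)%N].

(* Addition and integer multiples of pairs are the componentwise ones. *)
Definition is_AP3 (p : 'I_3 -> nat * nat) : Prop :=
  (forall j : 'I_3, posN2 (p j)) /\
  exists2 D : nat * nat, posN2 D & forall j : 'I_3, p j = p ord0 + D *+ j.

(* A sequence indexed by n >= 1 is a function on nat whose value at 0 is
   ignored. *)
Definition seq_graph (u : nat -> nat) : set (nat * nat) :=
  [set q | exists2 n : nat, (0 < n)%N & q = (n, u n)].

Definition contains_AP3 (A : set (nat * nat)) : Prop :=
  exists2 p : 'I_3 -> nat * nat, is_AP3 p & forall j : 'I_3, A (p j).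

(* On a nonnegative real, Num.truncn is the floor, as a natural number
   (truncn_floor). *)
Definition floor_pow (R : realType) (a : R) (n : nat) : nat :=
  Num.truncn (n%:R `^ a).

(* Main.v *)
Require Import Defs.
From mathcomp Require Import all_boot all_order all_algebra.
From mathcomp Require Import all_classical all_reals all_analysis.
From mathcomp Require Import zify lra.
Import Order.TTheory GRing.Theory Num.Theory.
Local Open Scope ring_scope.

(** The function [x `^ a] is so convex on [1, +oo[ that its second difference
    at a positive integer step is at least 2, the value reached by [x ^+ 2]
    at step 1.  Replacing three real numbers [x], [y], [z] by their floors
    changes [x - 2 * y + z] by less than 2, so the second difference of the
    floors is positive, whereas an arithmetic progression in the graph would
    make it vanish.

    The lower bound for the second difference comes from halving the
    exponent.  With [s] and [t] the values of [x `^ (a / 2)] at the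
    two ends, [s ^+ 2 + t ^+ 2] is half of [(s + t) ^+ 2 + (s - t) ^+ 2];
    here [s + t] is bounded below by convexity (lemma [powR_midpoint_le]) and
    [s - t] by expansivity (lemma [powR_expansive]), both of which hold as
    soon as the exponent [a / 2] is at least 1. *)

Lemma powR_midpoint_le (R : realType) (b x y : R) :
  1 <= b -> 0 <= x -> 0 <= y ->
  2 * ((x + y) / 2) `^ b <= x `^ b + y `^ b.
Proof.
move=> b1 x0 y0.
have h0 : (0 : R) <= 2^-1 by lra.
have h1 : (2^-1 : R) <= 1 by lra.
have := @convex_powR R b b1 (Itv01 h0 h1) x y.
rewrite !inE /= !in_itv /= !andbT => /(_ x0 y0).
rewrite convRE [X in X `^ _ <= _]convRE /= /unstable.onem.
have -> : 2^-1 * x + (1 - 2^-1) * y = (x + y) / 2 by lra.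
move: (_ `^ _) (_ `^ _) (_ `^ _) => u v w; lra.
Qed.

(** Both values are split as [z `^ b = z * z `^ (b - 1)], where the second
    factors are at least 1 and nondecreasing in [z]. *)
Lemma powR_expansive (R : realType) (b x y : R) :
  1 <= b -> 1 <= x -> x <= y -> y - x <= y `^ b - x `^ b.
Proof.
move=> b1 x1 xy.
have split z : 1 <= z -> z `^ b = z * z `^ (b - 1).
  move=> z1; rewrite -{2}(@powRr1 _ z) -?powRD; [by congr (_ `^ _); lra| |lra].
  by apply/implyP => _; rewrite gt_eqF //; lra.
rewrite !split //; last lra.
have b10 : 0 <= b - 1 by lra.
have U1 : 1 <= x `^ (b - 1).
  have : 1 `^ (b - 1) <= x `^ (b - 1).
    by apply: (ge0_ler_powR b10); rewrite ?nnegrE //; lra.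
  by rewrite powR1.
have UV : x `^ (b - 1) <= y `^ (b - 1).
  by apply: (ge0_ler_powR b10); rewrite ?nnegrE //; lra.
by move: (x `^ _) (y `^ _) U1 UV => u v U1 UV; nra.
Qed.

Lemma powR_second_difference_ge (R : realType) (a m d : R) :
  2 <= a -> 0 <= d -> 1 <= m - d ->
  2 * m `^ a + 2 * d ^+ 2 <= (m + d) `^ a + (m - d) `^ a.
Proof.
move=> a2 d0 md.
have b1 : 1 <= a / 2 by lra.
have sqE z : z `^ a = (z `^ (a / 2)) ^+ 2.
  by rewrite -powR_mulrn ?powR_ge0 // -powRrM; congr (_ `^ _); lra.
rewrite !sqE.
have mid := @powR_midpoint_le R (a / 2) (m + d) (m - d) b1.
rewrite (_ : (m + d + (m - d)) / 2 = m) in mid; last lra.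
have {mid} st : 2 * m `^ (a / 2) <= (m + d) `^ (a / 2) + (m - d) `^ (a / 2).
  by apply: mid; lra.
have ts : m + d - (m - d) <= (m + d) `^ (a / 2) - (m - d) `^ (a / 2).
  by apply: powR_expansive => //; lra.
have r0 := powR_ge0 m (a / 2).
move: r0 st ts.
move: (m `^ _) ((m + d) `^ _) ((m - d) `^ _) => r s t r0 st ts.
have h1 : (2 * r) ^+ 2 <= (s + t) ^+ 2 by rewrite ler_sqr ?nnegrE //; lra.
have h2 : (2 * d) ^+ 2 <= (s - t) ^+ 2 by rewrite ler_sqr ?nnegrE //; lra.
lra.
Qed.

Lemma floor_pow_second_difference_gt0 (R : realType) (a : R) (n d : nat) :
  2 <= a -> (0 < n)%N -> (0 < d)%N ->
  (2 * floor_pow a (n + d) < floor_pow a n + floor_pow a (n + d + d))%N.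
Proof.
move=> a2 n0 d0; rewrite -(ltr_nat R) natrM (natrD _ (floor_pow a n)) /floor_pow.
have floorP k := @truncn_itv R (k%:R `^ a) (powR_ge0 _ _).
have /andP[_ x_lt] := floorP n.
have /andP[y_ge _] := floorP (n + d)%N.
have /andP[_ z_lt] := floorP (n + d + d)%N.
have dR : 1 <= d%:R :> R by rewrite ler1n.
have nR : 1 <= n%:R :> R by rewrite ler1n.
have := @powR_second_difference_ge R a (n + d)%:R d%:R a2.
rewrite -(natrD _ (n + d)) (_ : (n + d)%:R - d%:R = n%:R); last by rewrite natrD addrK.
move=> /(_ (ler0n _ _) nR) sd.
have d2 : 1 <= (d%:R : R) ^+ 2 by rewrite exprn_ege1.
rewrite -!natr1 in x_lt z_lt.
lra.
Qed.

Theorem mainTheorem7 (R : realType) (a : R) (ha : 2 <= a) :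
  ~ contains_AP3 (seq_graph (floor_pow a)).
Proof.
move=> [p [_ [[d e] [/= d0 _] pE]] pG].
have [n n0 p0] := pG ord0.
have [n1 _ p1] := pG (inord 1).
have [n2 _ p2] := pG (inord 2).
have := pE (inord 1); have := pE (inord 2).
rewrite p0 p1 p2 !inordK // mulr1n mulr2n => -[n2E f2] [n1E f1].
have := @floor_pow_second_difference_gt0 R a n d ha n0 d0.
rewrite -[(n + d)%N]/(n + d) -n1E f1.
have -> : (n1 + d)%N = n2 by rewrite n2E n1E -addnA.
rewrite f2.
lia.
Qed.
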